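(* Let $I$ be a set. Let $\mathbf{QCA}$ be the category of $I$-dimensional quantum cylindric algebras and their homomorphisms, and let $\mathbf{CQIA}$ be the category of $I$-dimensional cylindric quasi-implication algebras and their homomorphisms. Then the category $\mathbf{QCA}$ is isomorphic to the category $\mathbf{CQIA}$.
   Context: An ortholattice is an algebra $\langle A;\wedge,\vee,{}^{\perp},0,1\rangle$ such that $\langle A;\wedge,\vee,0,1\rangle$ is a bounded lattice and $x\wedge x^\perp=0$, $x\vee x^\perp=1$, $x\le y\Rightarrow y^\perp\le x^\perp$, $x=x^{\perp\perp}$. It is an orthomodular lattice if $x\le y$ implies $y=x\vee(x^\perp\wedge y)$. A quantifier on an ortholattice $A$ is a map $\exists\colon A\to A$ with $\exists 0=0$, $x\le\exists x$, $\exists(x\vee y)=\exists x\vee\exists y$, $\exists\exists x=\exists x$, $\exists(\exists x)^\perp=(\exists x)^\perp$. An $I$-dimensional quantum cylindric algebra is a structure $\langle A;\wedge,\vee,{}^{\perp},0,1,(\exists_i)_{i\in I},(\delta_{i,k})_{i,k\in I}\rangle$ where $\langle A;\wedge,\vee,{}^{\perp},0,1\rangle$ is an orthomodular lattice, each $\exists_i$ is a quantifier, $\exists_i\exists_k a=\exists_k\exists_i a$ for all $i,k\in I$ and $a\in A$, and $\delta_{i,k}\in A$ are constants with $\delta_{i,k}=\delta_{k,i}$, $\delta_{i,i}=1$, and $\exists_k(\delta_{i,k}\wedge\delta_{k,l})=\delta_{i,l}$ whenever $i\neq k$ and $l\ne k$. A homomorphism $h\colon A\to A'$ of $I$-dimensional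 quantum cylindric algebras is a function with $h(x\wedge y)=h(x)\wedge h(y)$, $h(x\vee y)=h(x)\vee h(y)$, $h(x^\perp)=h(x)^\perp$, $h(0)=0'$, $h(1)=1'$, $h(\exists_i x)=\exists_i h(x)$, $h(\delta_{i,k})=\delta'_{i,k}$ for all $x,y\in A$ and $i,k\in I$. A quasi-implication algebra is a set $A$ with a binary operation $\cdot$ satisfying (1) $(x\cdot y)\cdot x=x$; (2) $(x\cdot y)\cdot(x\cdot z)=(y\cdot x)\cdot(y\cdot z)$; (3) $((x\cdot y)\cdot(y\cdot x))\cdot x=((y\cdot x)\cdot(x\cdot y))\cdot y$. In any quasi-implication algebra $x\cdot x=y\cdot y$ for all $x,y$, and one sets $1:=x\cdot x$. A bounded quasi-implication algebra is a quasi-implication algebra with a constant $0$ such that $0\cdot x=1$ for all $x$. A monadic quasi-implication algebra $\langle A;\cdot,0,\Diamond\rangle$ is a bounded quasi-implication algebra $\langle A;\cdot,0\rangle$ with a unary operation $\Diamond$ satisfying: (a) $\Diamond\Diamond x\cdot\Diamond x=1$ and $x\cdot\Diamond x=1$; (b) $\Diamond(\Diamond x\cdot 0)=\Diamond x\cdot 0$ and $\Diamond 0=0$; (c) $\Diamond(((x\cdot 0)\cdot(y\cdot 0))\cdot x)=((\Diamond x\cdot 0)\cdot(\Diamond y\cdot 0))\cdot\Diamond x$. ($\Diamond$ binds more tightly than $\cdot$.) An $I$-dimensional cylindric quasi-implication algebra is a structure $\langle A;\cdot,0,(\Diamond_i)_{i\in I},(d_{i,k})_{i,k\in I}\rangle$,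 with $d_{i,k}\in A$, such that: (1) $\langle A;\cdot,0,\Diamond_i\rangle$ is a monadic quasi-implication algebra for all $i\in I$; (2) $\Diamond_i\Diamond_k x=\Diamond_k\Diamond_i x$ for all $i,k\in I$ and $x\in A$; (3) $d_{i,k}=d_{k,i}$ and $d_{i,i}=1$ for all $i,k\in I$; (4) if $i\ne k$ and $l\neq k$ then $\Diamond_k(((d_{i,k}\cdot d_{k,l})\cdot(d_{i,k}\cdot 0))\cdot 0)=d_{i,l}$. A homomorphism $h\colon A\to A'$ of $I$-dimensional cylindric quasi-implication algebras is a function with $h(x\cdot y)=h(x)\cdot h(y)$, $h(\Diamond_i x)=\Diamond_i h(x)$, $h(d_{i,k})=d'_{i,k}$, $h(0)=0'$ for all $x,y\in A$ and $i,k\in I$. Two categories are isomorphic if there are functors between them, in both directions, whose two composites are equal to the identity functors.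
   Formalization: A cylindric quasi-implication algebra is explicitly required to have a bounded quasi-implication algebra as its reduct; this is automatic for nonempty I, but for empty I the literal definition admits all pointed magmas and the claim fails. *)

(* Defs.v *)
From mathcomp Require Import ssreflect ssrfun ssrbool boolp.

Set Implicit Arguments.
Unset Strict Implicit.
Unset Printing Implicit Defensive.

Record category := Category {
  obj : Type;
  hom : obj -> obj -> Type;
  idm : forall A, hom A A;
  compm : forall A B C, hom B C -> hom A B -> hom A C;
  compm1 : forall A B (f : hom A B), compm f (idm A) = f;
  comp1m : forall A B (f : hom A B), compm (idm B) f = f;
  compmA : forall A B C D (f : hom C D) (g : hom B C) (h : hom A B),
    compm f (compm g h) = compm (compm f g) h }.

Arguments idm {c} A.
Arguments compm {c A B C} f g.

Record functor (C D : category) := Functor {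
  fobj : obj C -> obj D;
  fmap : forall A B, hom A B -> hom (fobj A) (fobj B);
  fmap1 : forall A, fmap (idm A) = idm (fobj A);
  fmapM : forall A B E (f : hom B E) (g : hom A B),
    fmap (compm f g) = compm (fmap f) (fmap g) }.

Arguments fobj {C D} _ A.
Arguments fmap {C D} _ {A B} _.

Definition functor_id (C : category) : functor C C :=
  {| fobj := fun A => A;
     fmap := fun _ _ f => f;
     fmap1 := fun _ => erefl;
     fmapM := fun _ _ _ _ _ => erefl |}.

Section FunctorComp.
Variables (C D E : category) (G : functor D E) (F : functor C D).

Lemma functor_comp_map1 A : fmap G (fmap F (idm A)) = idm (fobj G (fobj F A)).
Proof. by rewrite !fmap1. Qed.

Lemma functor_comp_mapM A B X (f : hom B X) (g : hom A B) :
  fmap G (fmap F (compm f g)) =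
  compm (fmap G (fmap F f)) (fmap G (fmap F g)).
Proof. by rewrite !fmapM. Qed.

Definition functor_comp : functor C E :=
  {| fobj := fun A => fobj G (fobj F A);
     fmap := fun _ _ f => fmap G (fmap F f);
     fmap1 := functor_comp_map1;
     fmapM := functor_comp_mapM |}.
End FunctorComp.

(** Isomorphism, not mere equivalence: the composites are Leibniz-equal to the
    identity functors. *)
Definition isomorphic_categories (C D : category) : Prop :=
  exists (F : functor C D) (G : functor D C),
    functor_comp G F = functor_id C /\ functor_comp F G = functor_id D.

Section Lattices.
Variables (A : Type) (meet join : A -> A -> A) (perp : A -> A) (zero one : A).

Definition lat_le (x y : A) : Prop := meet x y = x.

Record is_bounded_lattice : Prop := IsBoundedLattice {
  lat_meetC : commutative meet;
  lat_joinC : commutative join;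
  lat_meetA : associative meet;
  lat_joinA : associative join;
  lat_meetKU : forall x y, meet x (join x y) = x;
  lat_joinKI : forall x y, join x (meet x y) = x;
  lat_le0 : forall x, lat_le zero x;
  lat_le1 : forall x, lat_le x one }.

Record is_ortholattice : Prop := IsOrtholattice {
  ol_lattice : is_bounded_lattice;
  ol_meet_perp : forall x, meet x (perp x) = zero;
  ol_join_perp : forall x, join x (perp x) = one;
  ol_perp_anti : forall x y, lat_le x y -> lat_le (perp y) (perp x);
  ol_perpK : forall x, x = perp (perp x) }.

Record is_orthomodular_lattice : Prop := IsOrthomodularLattice {
  oml_ortholattice : is_ortholattice;
  oml_orthomodular : forall x y, lat_le x y -> y = join x (meet (perp x) y) }.

Record is_quantifier (ex : A -> A) : Prop := IsQuantifier {
  quant0 : ex zero = zero;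
  quant_le : forall x, lat_le x (ex x);
  quant_join : forall x y, ex (join x y) = join (ex x) (ex y);
  quant_idem : forall x, ex (ex x) = ex x;
  quant_perp : forall x, ex (perp (ex x)) = perp (ex x) }.
End Lattices.

Record is_qca (I A : Type) (meet join : A -> A -> A) (perp : A -> A)
    (zero one : A) (ex : I -> A -> A) (delta : I -> I -> A) : Prop := IsQca {
  qca_oml : is_orthomodular_lattice meet join perp zero one;
  qca_quantifier : forall i, is_quantifier meet join perp zero (ex i);
  qca_exC : forall i k a, ex i (ex k a) = ex k (ex i a);
  qca_deltaC : forall i k, delta i k = delta k i;
  qca_delta1 : forall i, delta i i = one;
  qca_delta_ex : forall i k l, i <> k -> l <> k ->
    ex k (meet (delta i k) (delta k l)) = delta i l }.

Record qca (I : Type) := Qca {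
  qca_car :> Type;
  qca_meet : qca_car -> qca_car -> qca_car;
  qca_join : qca_car -> qca_car -> qca_car;
  qca_perp : qca_car -> qca_car;
  qca_zero : qca_car;
  qca_one : qca_car;
  qca_ex : I -> qca_car -> qca_car;
  qca_delta : I -> I -> qca_car;
  qca_axioms : is_qca qca_meet qca_join qca_perp qca_zero qca_one
                      qca_ex qca_delta }.

Arguments qca_zero {I} q.
Arguments qca_one {I} q.
Arguments qca_delta {I} q i k.

Record is_qca_hom (I : Type) (A B : qca I) (h : A -> B) : Prop := IsQcaHom {
  qca_homI : forall x y, h (qca_meet x y) = qca_meet (h x) (h y);
  qca_homU : forall x y, h (qca_join x y) = qca_join (h x) (h y);
  qca_homC : forall x, h (qca_perp x) = qca_perp (h x);
  qca_hom0 : h (qca_zero A) = qca_zero B;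
  qca_hom1 : h (qca_one A) = qca_one B;
  qca_hom_ex : forall i x, h (qca_ex i x) = qca_ex i (h x);
  qca_hom_delta : forall i k, h (qca_delta A i k) = qca_delta B i k }.

Record qca_hom (I : Type) (A B : qca I) := QcaHom {
  qca_fun :> A -> B;
  qca_funP : is_qca_hom qca_fun }.

Section QcaCategory.
Variable I : Type.

Lemma qca_hom_eq (A B : qca I) (f g : qca_hom A B) :
  qca_fun f = qca_fun g -> f = g.
Proof.
case: f g => [f fP] [g gP] /= e; move: gP; rewrite -e => gP.
by rewrite (Prop_irrelevance fP gP).
Qed.

Lemma qca_id_subproof (A : qca I) : is_qca_hom (fun x : A => x).
Proof. by []. Qed.

Lemma qca_comp_subproof (A B C : qca I) (f : qca_hom B C) (g : qca_hom A B) :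
  is_qca_hom (fun x => f (g x)).
Proof.
case: f g => [f [fI fU fC f0 f1 fE fD]] [g [gI gU gC g0 g1 gE gD]].
split=> /=; [move=> x y | move=> x y | move=> x | | | move=> i x | move=> i k].
- by rewrite gI fI.
- by rewrite gU fU.
- by rewrite gC fC.
- by rewrite g0 f0.
- by rewrite g1 f1.
- by rewrite gE fE.
- by rewrite gD fD.
Qed.

Definition qca_id (A : qca I) := QcaHom (qca_id_subproof A).
Definition qca_comp (A B C : qca I) (f : qca_hom B C) (g : qca_hom A B) :=
  QcaHom (qca_comp_subproof f g).

Lemma qca_compm1 (A B : qca I) (f : qca_hom A B) : qca_comp f (qca_id A) = f.
Proof. exact: qca_hom_eq. Qed.

Lemma qca_comp1m (A B : qca I) (f : qca_hom A B) : qca_comp (qca_id B) f = f.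
Proof. exact: qca_hom_eq. Qed.

Lemma qca_compmA (A B C D : qca I)
    (f : qca_hom C D) (g : qca_hom B C) (h : qca_hom A B) :
  qca_comp f (qca_comp g h) = qca_comp (qca_comp f g) h.
Proof. exact: qca_hom_eq. Qed.

Definition QCA : category := {|
  obj := qca I;
  hom := @qca_hom I;
  idm := qca_id;
  compm := qca_comp;
  compm1 := qca_compm1;
  comp1m := qca_comp1m;
  compmA := qca_compmA |}.
End QcaCategory.

Section QuasiImplication.
Variables (A : Type) (op : A -> A -> A).
Local Notation "x · y" := (op x y) (at level 40, left associativity).

Record is_qia : Prop := IsQia {
  qia_peirce : forall x y, (x · y) · x = x;
  qia_dist : forall x y z, (x · y) · (x · z) = (y · x) · (y · z);
  qia_comm : forall x y,
    ((x · y) · (y · x)) · x = ((y · x) · (x · y)) · y }.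

Lemma qia_one_unique : is_qia -> forall x y, x · x = y · y.
Proof.
case=> ax1 ax2 ax3.
have absorb x y : x · (x · y) = x · y by rewrite -{1}(ax1 x y) ax1.
have push x w z : (x · w) · (x · z) = x · ((x · w) · z).
  by rewrite -(absorb x w) ax2 ax1 absorb.
have sq x y : (y · x) · (y · x) = x · x by rewrite -ax2 push ax1.
by move=> x y; rewrite -(sq x ((x · y) · (y · x))) ax3 sq.
Qed.

Variable zero : A.

(** The element [1 := x · x] does not depend on [x] ([qia_one_unique]); it is
    instantiated at the constant available in every bounded algebra. *)
Definition qia_one : A := zero · zero.

Record is_bounded_qia : Prop := IsBoundedQia {
  bqia_qia : is_qia;
  bqia_zero : forall x, zero · x = qia_one }.

Lemma qia_oneE : is_bounded_qia -> forall x, x · x = qia_one.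
Proof. by move=> [Q _] x; apply: qia_one_unique. Qed.

Record is_monadic_qia (dia : A -> A) : Prop := IsMonadicQia {
  mqia_bounded : is_bounded_qia;
  mqia_dia_dia : forall x, dia (dia x) · dia x = qia_one;
  mqia_le_dia : forall x, x · dia x = qia_one;
  mqia_dia_neg : forall x, dia (dia x · zero) = dia x · zero;
  mqia_dia0 : dia zero = zero;
  mqia_dia_join : forall x y,
    dia (((x · zero) · (y · zero)) · x) =
    ((dia x · zero) · (dia y · zero)) · dia x }.

(** [cqia_bounded] follows from [cqia_monadic] as soon as [I] is inhabited; it
    is listed so that [op] and [zero] are still constrained when [I] is
    empty. *)
Record is_cqia (I : Type) (dia : I -> A -> A) (d : I -> I -> A) : Prop :=
  IsCqia {
  cqia_bounded : is_bounded_qia;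
  cqia_monadic : forall i, is_monadic_qia (dia i);
  cqia_diaC : forall i k x, dia i (dia k x) = dia k (dia i x);
  cqia_dC : forall i k, d i k = d k i;
  cqia_d1 : forall i, d i i = qia_one;
  cqia_d_dia : forall i k l, i <> k -> l <> k ->
    dia k (((d i k · d k l) · (d i k · zero)) · zero) = d i l }.
End QuasiImplication.

Record cqia (I : Type) := Cqia {
  cqia_car :> Type;
  cqia_op : cqia_car -> cqia_car -> cqia_car;
  cqia_zero : cqia_car;
  cqia_dia : I -> cqia_car -> cqia_car;
  cqia_d : I -> I -> cqia_car;
  cqia_axioms : is_cqia cqia_op cqia_zero cqia_dia cqia_d }.

Arguments cqia_zero {I} c.
Arguments cqia_d {I} c i k.

Record is_cqia_hom (I : Type) (A B : cqia I) (h : A -> B) : Prop :=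
  IsCqiaHom {
  cqia_hom_op : forall x y, h (cqia_op x y) = cqia_op (h x) (h y);
  cqia_hom_dia : forall i x, h (cqia_dia i x) = cqia_dia i (h x);
  cqia_hom_d : forall i k, h (cqia_d A i k) = cqia_d B i k;
  cqia_hom0 : h (cqia_zero A) = cqia_zero B }.

Record cqia_hom (I : Type) (A B : cqia I) := CqiaHom {
  cqia_fun :> A -> B;
  cqia_funP : is_cqia_hom cqia_fun }.

Section CqiaCategory.
Variable I : Type.

Lemma cqia_hom_eq (A B : cqia I) (f g : cqia_hom A B) :
  cqia_fun f = cqia_fun g -> f = g.
Proof.
case: f g => [f fP] [g gP] /= e; move: gP; rewrite -e => gP.
by rewrite (Prop_irrelevance fP gP).
Qed.

Lemma cqia_id_subproof (A : cqia I) : is_cqia_hom (fun x : A => x).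
Proof. by []. Qed.

Lemma cqia_comp_subproof (A B C : cqia I)
    (f : cqia_hom B C) (g : cqia_hom A B) :
  is_cqia_hom (fun x => f (g x)).
Proof.
case: f g => [f [fM fE fD f0]] [g [gM gE gD g0]].
split=> /=; [move=> x y | move=> i x | move=> i k |].
- by rewrite gM fM.
- by rewrite gE fE.
- by rewrite gD fD.
- by rewrite g0 f0.
Qed.

Definition cqia_id (A : cqia I) := CqiaHom (cqia_id_subproof A).
Definition cqia_comp (A B C : cqia I) (f : cqia_hom B C) (g : cqia_hom A B) :=
  CqiaHom (cqia_comp_subproof f g).

Lemma cqia_compm1 (A B : cqia I) (f : cqia_hom A B) : cqia_comp f (cqia_id A) = f.
Proof. exact: cqia_hom_eq. Qed.

Lemma cqia_comp1m (A B : cqia I) (f : cqia_hom A B) : cqia_comp (cqia_id B) f = f.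
Proof. exact: cqia_hom_eq. Qed.

Lemma cqia_compmA (A B C D : cqia I)
    (f : cqia_hom C D) (g : cqia_hom B C) (h : cqia_hom A B) :
  cqia_comp f (cqia_comp g h) = cqia_comp (cqia_comp f g) h.
Proof. exact: cqia_hom_eq. Qed.

Definition CQIA : category := {|
  obj := cqia I;
  hom := @cqia_hom I;
  idm := cqia_id;
  compm := cqia_comp;
  compm1 := cqia_compm1;
  comp1m := cqia_comp1m;
  compmA := cqia_compmA |}.
End CqiaCategory.

(* Main.v *)
Require Import Defs.
From mathcomp Require Import ssreflect ssrfun boolp.

(** The isomorphism does not change carriers or underlying functions, only the
    signature.  An orthomodular lattice carries the Sasaki hook
    [x · y = x^⊥ ∨ (x ∧ y)], and the lattice operations are recovered from it as
    the terms
    [x^⊥ = x · 0], [x ∧ y = ((x · y) · x^⊥)^⊥] and [x ∨ y = (x^⊥ · y^⊥) · x].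
    The last two are exactly the terms appearing in the axioms for [◇] and for
    the diagonal constants, so the cylindric structure is carried over verbatim
    once the two signatures are known to be interdefinable.

    From lattices to quasi-implications, everything rests on the orthomodular
    law saying that [a ↦ x^⊥ ∨ a] is an isomorphism from the interval below [x]
    to the interval above [x^⊥], with inverse meeting with [x].  It yields
    [(x · y) · (x · z) = (x ∧ y) · z] ([hook_hook]), whose right side explains
    the exchange axiom [qia_dist], and it evaluates both sides of [qia_comm] to
    the same expression, symmetric in [x] and [y] ([hook_comm_sym]).

    Conversely, in a bounded quasi-implication algebra [x ≤ y :<-> x · y = 1] is
    a partial order, [x ↦ x · 0] is an antitone involution ([qneg_anti], [qnegK]),
    and the instance [(x · y) · x^⊥ = (y · x) · y^⊥] of the exchange axiom is the
    commutativity of the meet term.  That this term is the greatest lower bound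
    ([qmeet_glb]) follows from [x · z ≤ x · y] for [z ≤ x] and [z ≤ y]
    ([qle_op_mono]), and from the antitonicity of [- · c] above [c]
    ([qle_op_anti]).  The orthomodular law comes down to
    [a^⊥ · b = b] for [a ≤ b] ([qop_neg_ge]).

    All structure maps in both directions are terms, so homomorphisms of one
    kind are homomorphisms of the other.  Both composites fix objects by
    extensionality, and fix morphisms because a morphism is determined by its
    underlying function; [functor_eq_id] deals with the transport along the
    equalities between objects. *)

Set Implicit Arguments.
Unset Strict Implicit.
Unset Printing Implicit Defensive.

(** * The Sasaki hook of an orthomodular lattice *)

Definition hook (A : Type) (meet join : A -> A -> A) (perp : A -> A) (x y : A) :=
  join (perp x) (meet x y).

Section SasakiHook.
Variables (A : Type) (meet join : A -> A -> A) (perp : A -> A) (zero one : A).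
Hypothesis oml : is_orthomodular_lattice meet join perp zero one.

Local Notation "x ∧ y" := (meet x y) (at level 40, left associativity).
Local Notation "x ∨ y" := (join x y) (at level 50, left associativity).
Local Notation "x ^⊥" := (perp x) (at level 2, left associativity, format "x ^⊥").
Local Notation "x ≤ y" := (lat_le meet x y) (at level 70).
Local Notation "x · y" := (hook meet join perp x y)
  (at level 40, left associativity).

Let ol := oml_ortholattice oml.
Let bl := ol_lattice ol.
Let meetC := lat_meetC bl.
Let joinC := lat_joinC bl.
Let meetA := lat_meetA bl.
Let joinA := lat_joinA bl.
Let meetKU := lat_meetKU bl.
Let joinKI := lat_joinKI bl.
Let perpK x : x^⊥^⊥ = x. Proof. by rewrite -(ol_perpK ol). Qed.

Let meetxx x : x ∧ x = x.
Proof. by rewrite -{2}(joinKI x x) meetKU. Qed.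

Let leIl x y : x ∧ y ≤ x.
Proof. by rewrite /lat_le meetC meetA meetxx. Qed.

Let leUl x y : x ≤ x ∨ y.
Proof. exact: meetKU. Qed.

Let leUr x y : y ≤ x ∨ y.
Proof. by rewrite joinC; apply: leUl. Qed.

Let le_anti x y : x ≤ y -> y ≤ x -> x = y.
Proof. by rewrite /lat_le => xy yx; rewrite -xy meetC. Qed.

Let lexI x y z : z ≤ x -> z ≤ y -> z ≤ x ∧ y.
Proof. by rewrite /lat_le meetA => -> ->. Qed.

Let le_trans x y z : x ≤ y -> y ≤ z -> x ≤ z.
Proof. by rewrite /lat_le => xy yz; rewrite -{1}xy -meetA yz. Qed.

Let join_r x y : x ≤ y -> x ∨ y = y.
Proof. by rewrite /lat_le => <-; rewrite joinC meetC joinKI. Qed.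

Let leUx x y z : x ≤ z -> y ≤ z -> x ∨ y ≤ z.
Proof.
move=> xz yz; rewrite /lat_le.
by rewrite -(join_r xz) -(join_r yz) joinA meetKU.
Qed.

Let perp_le x y : x ≤ y -> y^⊥ ≤ x^⊥.
Proof. exact: ol_perp_anti ol _ _. Qed.

Let perpU x y : (x ∨ y)^⊥ = x^⊥ ∧ y^⊥.
Proof.
apply: le_anti; first by apply: lexI; apply: perp_le.
rewrite -(perpK (x^⊥ ∧ _)); apply: perp_le; apply: leUx.
  by rewrite -{1}(perpK x); apply: perp_le.
by rewrite -{1}(perpK y); apply: perp_le; rewrite meetC.
Qed.

Let perpI x y : (x ∧ y)^⊥ = x^⊥ ∨ y^⊥.
Proof. by rewrite -(perpK (_ ∨ _)) perpU !perpK. Qed.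

Let om x y : x ≤ y -> x ∨ (x^⊥ ∧ y) = y.
Proof. by move=> /(oml_orthomodular oml) <-. Qed.

(** The orthomodular law read in the dual lattice: meeting with [x] undoes
    joining with [x^⊥]. *)
Lemma orthomodular_dual a x : a ≤ x -> x ∧ (x^⊥ ∨ a) = a.
Proof.
move=> /perp_le /om; rewrite perpK => /(congr1 perp).
by rewrite perpU !perpI !perpK.
Qed.

Lemma perp_hook x y : (x · y)^⊥ = (x ∧ y)^⊥ ∧ x.
Proof. by rewrite /hook perpU perpK meetC. Qed.

Lemma meet_hook x y : x ∧ (x · y) = x ∧ y.
Proof. exact: orthomodular_dual. Qed.

Lemma hook_le x y : x ≤ y -> x · y = one.
Proof. by rewrite /hook => ->; rewrite joinC (ol_join_perp ol). Qed.

Lemma hook_ge x y : y ≤ x -> x · y = x^⊥ ∨ y.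
Proof. by rewrite /hook /lat_le meetC => ->. Qed.

Lemma hookx0 x : x · zero = x^⊥.
Proof.
rewrite /hook (_ : x ∧ zero = zero); last by rewrite meetC; apply: lat_le0 bl x.
by rewrite joinC join_r //; apply: lat_le0 bl _.
Qed.

Lemma hook0x x : zero · x = zero · zero.
Proof. by rewrite !hook_le //; apply: lat_le0 bl _. Qed.

Lemma hook00 : zero · zero = one.
Proof. by apply: hook_le; apply: lat_le0 bl _. Qed.

Lemma hook_peirce x y : (x · y) · x = x.
Proof. by rewrite {1}/hook (meetC _ x) meet_hook perp_hook joinC om. Qed.

(** The element [t = (x · y) ∧ (x · z)] lies above [x^⊥], hence is
    [x^⊥ ∨ (x ∧ t)], and meeting with [x] undoes both hooks. *)
Lemma hook_hook x y z : (x · y) · (x · z) = (x ∧ y) · z.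
Proof.
have tE : (x · y) ∧ (x · z) = x^⊥ ∨ ((x ∧ y) ∧ z).
  have /om <- : x^⊥ ≤ (x · y) ∧ (x · z) by apply: lexI; apply: leUl.
  by rewrite perpK meetA meet_hook -(meetA x) (meetC y) meetA meet_hook
             -!meetA (meetC z).
have x'E : x^⊥ ∨ (x ∧ (x ∧ y)^⊥) = (x ∧ y)^⊥.
  by rewrite -{2}(perpK x) om //; apply: perp_le.
by rewrite {1}/hook tE perp_hook joinA (meetC _ x) (joinC _ x^⊥) x'E.
Qed.

(** With [p = x · y] and [q = y · x], the element [p · q] lies above
    [x = (x ∧ y) ∨ p^⊥], so the outer hook is [(p · q)^⊥ ∨ x]; since
    [(p · q)^⊥ = p ∧ (p^⊥ ∨ q^⊥)], joining it with [p^⊥] gives [p^⊥ ∨ q^⊥]. *)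
Lemma hook_comm_sym x y :
  ((x · y) · (y · x)) · x = (x ∧ y) ∨ ((x · y)^⊥ ∨ (y · x)^⊥).
Proof.
set p := x · y; set q := y · x.
have xE : x = (x ∧ y) ∨ p^⊥ by rewrite perp_hook om.
have le_xr : x ≤ p · q.
  rewrite {1}xE; apply: leUx; last exact: leUl.
  apply: (le_trans (y := p ∧ q)); last exact: leUr.
  by apply: lexI; [apply: leUr | rewrite meetC; apply: leUr].
rewrite hook_ge // joinC {1}xE (perp_hook p q) (perpI p q) (meetC _ p)
           -joinA -{2}(perpK p) om //.
Qed.

Lemma hook_comm x y :
  ((x · y) · (y · x)) · x = ((y · x) · (x · y)) · y.
Proof. by rewrite !hook_comm_sym meetC (joinC (x · y)^⊥). Qed.

Lemma hook_is_qia : is_qia (hook meet join perp).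
Proof.
split; [exact: hook_peirce | | exact: hook_comm].
by move=> x y z; rewrite !hook_hook meetC.
Qed.

Lemma hook_is_bounded_qia : is_bounded_qia (hook meet join perp) zero.
Proof. by split; [exact: hook_is_qia | exact: hook0x]. Qed.

Lemma hook_join x y : ((x · zero) · (y · zero)) · x = x ∨ y.
Proof.
rewrite !hookx0 hook_ge; last by rewrite /hook perpK; apply: leUl.
by rewrite perp_hook perpI !perpK joinC (meetC _ x^⊥) om.
Qed.

Lemma hook_meet x y : ((x · y) · (x · zero)) · zero = x ∧ y.
Proof.
rewrite !hookx0 hook_ge; last exact: leUl.
by rewrite perpU !perpK meetC meet_hook.
Qed.

Lemma hook_is_monadic_qia ex : is_quantifier meet join perp zero ex ->
  is_monadic_qia (hook meet join perp) zero ex.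
Proof.
case=> ex0 le_ex exU exK exN; split=> //.
- exact: hook_is_bounded_qia.
- by move=> x; rewrite exK /qia_one !hook_le //; apply: meetxx.
- by move=> x; rewrite /qia_one hook00 hook_le.
- by move=> x; rewrite !hookx0.
- by move=> x y; rewrite !hook_join.
Qed.

End SasakiHook.

Lemma hook_is_cqia (I A : Type) (meet join : A -> A -> A) (perp : A -> A)
    (zero one : A) (ex : I -> A -> A) (delta : I -> I -> A) :
  is_qca meet join perp zero one ex delta ->
  is_cqia (hook meet join perp) zero ex delta.
Proof.
case=> oml exQ exC dC d1 dex; split=> //.
- exact: hook_is_bounded_qia oml.
- by move=> i; apply: hook_is_monadic_qia oml _ (exQ i).
- by move=> i; rewrite d1 /qia_one (hook00 oml).
- by move=> i k l ik lk; rewrite (hook_meet oml) dex.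
Qed.

(** * The orthomodular lattice of a bounded quasi-implication algebra *)

Section LatticeOperations.
Variables (A : Type) (op : A -> A -> A) (zero : A).
Definition qneg x := op x zero.
Definition qmeet x y := qneg (op (op x y) (qneg x)).
Definition qjoin x y := op (op (qneg x) (qneg y)) x.
End LatticeOperations.

Section QuasiImplicationLattice.
Variables (A : Type) (op : A -> A -> A) (zero : A).
Hypothesis bqia : is_bounded_qia op zero.

Local Notation "x · y" := (op x y) (at level 40, left associativity).
Local Notation "x ^⊥" := (qneg op zero x)
  (at level 2, left associativity, format "x ^⊥").
Local Notation "x ∧ y" := (qmeet op zero x y) (at level 40, left associativity).
Local Notation "x ∨ y" := (qjoin op zero x y) (at level 50, left associativity).
Local Notation "1" := (qia_one op zero).
Local Notation "x ≤ y" := (x · y = 1) (at level 70).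

Let peirce := qia_peirce (bqia_qia bqia).
Let dist := qia_dist (bqia_qia bqia).
Let comm := qia_comm (bqia_qia bqia).
Let opxx : forall x, x · x = 1 := qia_oneE bqia.
Let op0x : forall x, zero · x = 1 := bqia_zero bqia.

Let op1x x : 1 · x = x.
Proof. by rewrite -(opxx x) peirce. Qed.

(** [x · (x · y)] is [((x · y) · x) · (x · y)], a second instance of
    [(u · v) · u = u]. *)
Lemma qop_idem x y : x · (x · y) = x · y.
Proof. by rewrite -{1}(peirce x y) peirce. Qed.

Lemma qop_push x y z : (x · y) · (x · z) = x · ((x · y) · z).
Proof. by rewrite -(qop_idem x y) dist peirce qop_idem. Qed.

Let opx1 x : x · 1 = 1.
Proof. by rewrite -(opxx x) qop_idem. Qed.

Let qle_anti x y : x ≤ y -> y ≤ x -> x = y.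
Proof. by move=> xy yx; have := comm x y; rewrite xy yx !op1x. Qed.

(** The exchange axiom for comparable elements: a hook out of [x] is determined
    by the hooks out of any larger [y].  Most of the order theory below consists
    of instances of this identity. *)
Lemma qop_le x y z : x ≤ y -> x · z = (y · x) · (y · z).
Proof. by move=> xy; rewrite -dist xy op1x. Qed.

Let qle_trans x y z : x ≤ y -> y ≤ z -> x ≤ z.
Proof. by move=> xy yz; rewrite (qop_le z xy) yz opx1. Qed.

Lemma qle_op x y : x ≤ y -> x ≤ y · x.
Proof. by move=> /qop_le ->; rewrite qop_idem opxx. Qed.

Lemma qopK x y : x ≤ y -> (y · x) · x = y.
Proof. by move=> xy; have := comm x y; rewrite xy op1x opx1 op1x. Qed.

Lemma qle_op_mono x y z : z ≤ x -> z ≤ y -> x · z ≤ x · y.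
Proof. by move=> /qop_le zx zy; rewrite -zx. Qed.

(** Going down from [y] to [x], the element [x · z] becomes
    [y · ((y · x) · z)] by [qop_le] and [qop_push], and [z ≤ (y · x) · z]. *)
Lemma qle_op_anti x y z : z ≤ x -> x ≤ y -> y · z ≤ x · z.
Proof.
move=> zx xy; have zy := qle_trans zx xy.
rewrite (qop_le z xy) qop_push; apply: qle_op_mono => //.
apply: qle_op; apply: qle_trans (qle_op zy) _; exact: qle_op_mono.
Qed.

Let qle0x x : zero ≤ x. Proof. exact: op0x. Qed.

Lemma qneg_le_op x y : x^⊥ ≤ x · y.
Proof. by rewrite /qneg dist !op0x opxx. Qed.

Let opxN x : x · x^⊥ = x^⊥.
Proof. exact: qop_idem. Qed.

Let opNx x : x^⊥ · x = x.
Proof. exact: peirce. Qed.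

Lemma qneg_anti x y : x ≤ y -> y^⊥ ≤ x^⊥.
Proof. by move=> xy; apply: qle_op_anti. Qed.

Lemma qle_negneg x : x ≤ x^⊥^⊥.
Proof.
by have := dist x x^⊥ zero; rewrite opxN opNx -/(x^⊥) opxx => <-.
Qed.

(** [x ≤ x^⊥^⊥] already gives [x^⊥^⊥^⊥ = x^⊥]; then [w = x^⊥^⊥ · x] satisfies
    [w · x^⊥ = x^⊥] with [x^⊥ ≤ w], which forces [w = 1] by [qopK]. *)
Lemma qnegK x : x^⊥^⊥ = x.
Proof.
have le_xx := qle_negneg x.
have nnn : x^⊥^⊥^⊥ = x^⊥.
  by apply: qle_anti; [apply: qneg_anti | apply: qle_negneg].
apply: qle_anti => //; set w := _ · x.
have wE : w · x^⊥ = x^⊥.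
  by rewrite /w -{2}nnn -(qop_le zero le_xx).
have : x^⊥ ≤ w by rewrite -nnn; apply: qneg_le_op.
by move=> /qopK; rewrite wE opxx.
Qed.

(** The exchange axiom with [z = 0]. *)
Let qmeetC x y : x ∧ y = y ∧ x.
Proof. by rewrite /qmeet /qneg dist. Qed.

Lemma qmeet_lel x y : x ∧ y ≤ x.
Proof.
rewrite -{2}(qnegK x); apply: qneg_anti; apply: qle_op; exact: qneg_le_op.
Qed.

Let qmeet_ler x y : x ∧ y ≤ y.
Proof. by rewrite qmeetC; apply: qmeet_lel. Qed.

Let qmeet_l x y : x ≤ y -> x ∧ y = x.
Proof. by rewrite /qmeet => ->; rewrite op1x qnegK. Qed.

(** Here [z = x ∧ z], so the claim compares [(x · y) · x^⊥] with
    [(x · z) · x^⊥], where [x^⊥ ≤ x · z ≤ x · y]. *)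
Lemma qmeet_glb x y z : z ≤ x -> z ≤ y -> z ≤ x ∧ y.
Proof.
move=> zx zy; rewrite -{1}(qmeet_l zx) qmeetC.
apply: qneg_anti; apply: qle_op_anti; first exact: qneg_le_op.
exact: qle_op_mono.
Qed.

Let qleE x y : lat_le (qmeet op zero) x y <-> x ≤ y.
Proof. by split=> [<-|/qmeet_l //]; apply: qmeet_ler. Qed.

Lemma qjoinE x y : x ∨ y = (x^⊥ ∧ y^⊥)^⊥.
Proof. by rewrite /qmeet !qnegK. Qed.

Let qle_joinl x y : x ≤ x ∨ y.
Proof. by apply: qle_op; rewrite -{1}(qnegK x); apply: qneg_le_op. Qed.

Let qjoinC x y : x ∨ y = y ∨ x.
Proof. by rewrite !qjoinE qmeetC. Qed.

Let qmeetA x y z : x ∧ (y ∧ z) = x ∧ y ∧ z.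
Proof.
have le_l a b c : a ≤ c -> a ∧ b ≤ c by apply: qle_trans; apply: qmeet_lel.
have le_r a b c : b ≤ c -> a ∧ b ≤ c by apply: qle_trans; apply: qmeet_ler.
apply: qle_anti; apply: qmeet_glb; try apply: qmeet_glb.
- exact: qmeet_lel.
- by apply: le_r; apply: qmeet_lel.
- by apply: le_r; apply: qmeet_ler.
- by apply: le_l; apply: qmeet_lel.
- by apply: le_l; apply: qmeet_ler.
- exact: qmeet_ler.
Qed.

Let qjoin_r x y : y ≤ x -> x ∨ y = x.
Proof. by move=> /qneg_anti; rewrite qjoinE => /qmeet_l ->; rewrite qnegK. Qed.

Lemma qlattice : is_bounded_lattice (qmeet op zero) (qjoin op zero) zero 1.
Proof.
split=> //.
- by move=> x y z; rewrite !qjoinE !(qnegK (_ ∧ _)) qmeetA.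
- by move=> x y; apply: qmeet_l.
- by move=> x y; apply: qjoin_r; apply: qmeet_lel.
- by move=> x; apply: qmeet_l.
- by move=> x; apply: qmeet_l.
Qed.

Lemma qortholattice :
  is_ortholattice (qmeet op zero) (qjoin op zero) (qneg op zero) zero 1.
Proof.
have meetN x : x ∧ x^⊥ = zero by rewrite /qmeet opxN opxx; apply: op1x.
split=> //.
- exact: qlattice.
- by move=> x; rewrite qjoinE qnegK qmeetC meetN; apply: op0x.
- by move=> x y /qleE /qneg_anti /qleE.
- by move=> x; rewrite qnegK.
Qed.

(** The orthomodular law in hook form, [a^⊥ · b] being [a ∨ (a^⊥ ∧ b)].  Since
    [b^⊥ ≤ a^⊥], the element [b = b^⊥^⊥] is [(a^⊥ · b^⊥) · (a^⊥ · 0)]; by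
    [qop_push], a hook out of [a^⊥] can be moved onto [a^⊥ · 0], which absorbs
    it. *)
Lemma qop_neg_ge a b : a ≤ b -> a^⊥ · b = b.
Proof.
move=> /qneg_anti ba.
have bE : b = (a^⊥ · b^⊥) · a^⊥^⊥ by rewrite -{1}(qnegK b); apply: qop_le.
by rewrite {1}bE -qop_push opxN -bE.
Qed.

(** Rebuilding the hook from the lattice operations gives back the original
    operation: [x · y] lies above [x^⊥], where [qopK] applies. *)
Lemma hook_qlattice x y :
  hook (qmeet op zero) (qjoin op zero) (qneg op zero) x y = x · y.
Proof.
rewrite /hook /qjoin /qmeet !qnegK -qop_push opxN.
by apply: qopK; apply: qneg_le_op.
Qed.

Lemma qorthomodular :
  is_orthomodular_lattice (qmeet op zero) (qjoin op zero) (qneg op zero) zero 1.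
Proof.
split=> [|x y /qleE /qop_neg_ge]; first exact: qortholattice.
by rewrite -hook_qlattice /hook qnegK => ->.
Qed.

Lemma qquantifier dia : is_monadic_qia op zero dia ->
  is_quantifier (qmeet op zero) (qjoin op zero) (qneg op zero) zero dia.
Proof.
case=> _ diaK le_dia diaN dia0 diaU; split=> //.
- by move=> x; apply/qleE.
- by move=> x; apply: qle_anti.
Qed.

End QuasiImplicationLattice.

Lemma qlattice_is_qca (I A : Type) (op : A -> A -> A) (zero : A)
    (dia : I -> A -> A) (d : I -> I -> A) :
  is_cqia op zero dia d ->
  is_qca (qmeet op zero) (qjoin op zero) (qneg op zero) zero (qia_one op zero)
         dia d.
Proof.
case=> bqia diaM diaC dC d1 ddia; split=> //.
- exact: qorthomodular.
- by move=> i; apply: qquantifier.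
Qed.

(** * The two functors *)

Definition cqia_of_qca (I : Type) (A : qca I) : cqia I :=
  Cqia (hook_is_cqia (qca_axioms A)).

Definition qca_of_cqia (I : Type) (A : cqia I) : qca I :=
  Qca (qlattice_is_qca (cqia_axioms A)).

Lemma cqia_of_qca_hom (I : Type) (A B : qca I) (f : qca_hom A B) :
  @is_cqia_hom I (cqia_of_qca A) (cqia_of_qca B) f.
Proof.
case: f => f [fI fU fN f0 f1 fE fD]; split=> //= x y.
by rewrite /hook fU fN fI.
Qed.

Lemma qca_of_cqia_hom (I : Type) (A B : cqia I) (f : cqia_hom A B) :
  @is_qca_hom I (qca_of_cqia A) (qca_of_cqia B) f.
Proof.
case: f => f [fM fE fD f0]; split=> //=.
- by move=> x y; rewrite /qmeet /qneg !fM f0.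
- by move=> x y; rewrite /qjoin /qneg !fM f0.
- by move=> x; rewrite /qneg fM f0.
- by rewrite /qia_one fM f0.
Qed.

Definition CQIA_of_QCA (I : Type) : functor (QCA I) (CQIA I).
Proof.
refine (@Functor (QCA I) (CQIA I) (@cqia_of_qca I)
  (fun A B f => CqiaHom (cqia_of_qca_hom f)) _ _) => *; exact: cqia_hom_eq.
Defined.

Definition QCA_of_CQIA (I : Type) : functor (CQIA I) (QCA I).
Proof.
refine (@Functor (CQIA I) (QCA I) (@qca_of_cqia I)
  (fun A B f => QcaHom (qca_of_cqia_hom f)) _ _) => *; exact: qca_hom_eq.
Defined.

(** * The composites are identities *)

Lemma qca_of_cqiaK (I : Type) (A : qca I) : qca_of_cqia (cqia_of_qca A) = A.
Proof.
case: A => A meet join perp zero one ex delta ax; have oml := qca_oml ax.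
rewrite /qca_of_cqia /=; move: (qlattice_is_qca _) => /=.
have -> : qmeet (hook meet join perp) zero = meet.
  by apply/funext => x; apply/funext => y; apply: hook_meet oml _ _.
have -> : qjoin (hook meet join perp) zero = join.
  by apply/funext => x; apply/funext => y; apply: hook_join oml _ _.
have -> : qneg (hook meet join perp) zero = perp.
  by apply/funext => x; apply: hookx0 oml _.
rewrite /qia_one (hook00 oml) => ax'.
by rewrite (Prop_irrelevance ax' ax).
Qed.

Lemma cqia_of_qcaK (I : Type) (A : cqia I) : cqia_of_qca (qca_of_cqia A) = A.
Proof.
case: A => A op zero dia d ax; have bqia := cqia_bounded ax.
rewrite /cqia_of_qca /=; move: (hook_is_cqia _) => /=.
have -> : hook (qmeet op zero) (qjoin op zero) (qneg op zero) = op.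
  by apply/funext => x; apply/funext => y; apply: hook_qlattice.
by move=> ax'; rewrite (Prop_irrelevance ax' ax).
Qed.

(** Transport in a family [U] only depends on the induced equality of types, so
    it is invisible when the two fibres are the same type. *)
Lemma transport_fibre (T : Type) (U : T -> Type) (a b : T) (e : a = b)
    (E : U a = U b) (x : U a) :
  eq_rect a U x b e = eq_rect (U a) id x (U b) E.
Proof. by case: b / e E => E; rewrite (Prop_irrelevance E erefl). Qed.

(** In a concrete category (with [u] the underlying functions), an endofunctor
    that fixes the objects and, up to transport, the underlying functions is
    the identity. *)
Lemma functor_eq_id (C : category) (U : obj C -> Type)
    (u : forall A B, hom A B -> U A -> U B)
    (u_inj : forall A B (f g : hom A B), u A B f = u A B g -> f = g)
    (H : functor C C) (e : forall A, fobj H A = A) :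
  (forall A B (f : hom A B) x,
     u A B f (eq_rect _ U x _ (e A)) = eq_rect _ U (u _ _ (fmap H f) x) _ (e B)) ->
  H = functor_id C.
Proof.
case: H e => H h h1 hM /= e uE.
(* The object maps are identified first, so that [H] can be replaced by [id]
   everywhere and only transports along a proof of [id = id] remain. *)
have idH : id = H by apply/funext => A; rewrite /= e.
have {e}uE A B (f : hom A B) x :
    u A B f (eq_rect _ (fun K => U (K A)) x _ (esym idH)) =
    eq_rect _ (fun K => U (K B)) (u _ _ (h A B f) x) _ (esym idH).
  have red D (y : U (H D)) :
      eq_rect _ (fun K => U (K D)) y _ (esym idH) = eq_rect _ U y _ (e D).
    by rewrite (transport_fibre (e D) (f_equal U (e D))); apply: transport_fibre.
  by rewrite !red.
case: H / idH h h1 hM uE => h h1 hM /= uE.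
have hE : (fun _ _ f => f) = h.
  apply: functional_extensionality_dep => A.
  apply: functional_extensionality_dep => B.
  by apply/funext => f; apply: u_inj; apply/funext => x; rewrite -uE.
case: h / hE h1 hM {uE} => h1 hM.
by rewrite /functor_id; congr Functor; apply: Prop_irrelevance.
Qed.

Theorem theorem3p22 (I : Type) : isomorphic_categories (QCA I) (CQIA I).
Proof.
exists (CQIA_of_QCA I), (QCA_of_CQIA I); split.
- refine (@functor_eq_id (QCA I) (@qca_car I) (@qca_fun I) (@qca_hom_eq I)
            (functor_comp (QCA_of_CQIA I) (CQIA_of_QCA I)) (@qca_of_cqiaK I) _).
  move=> A B f x.
  have carE D y : eq_rect _ (@qca_car I) y _ (@qca_of_cqiaK I D) = y.
    exact: (transport_fibre (qca_of_cqiaK D) (erefl (qca_car D))).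
  by rewrite !carE.
- refine (@functor_eq_id (CQIA I) (@cqia_car I) (@cqia_fun I) (@cqia_hom_eq I)
            (functor_comp (CQIA_of_QCA I) (QCA_of_CQIA I)) (@cqia_of_qcaK I) _).
  move=> A B f x.
  have carE D y : eq_rect _ (@cqia_car I) y _ (@cqia_of_qcaK I D) = y.
    exact: (transport_fibre (cqia_of_qcaK D) (erefl (cqia_car D))).
  by rewrite !carE.
Qed.
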